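(* Let $\mathcal A$ be a real Banach space and $\mathcal B=\mathcal A'$ its dual, with weak\* topology $w^*$. Let $\Theta$ be a parameter set, $\theta\mapsto f_\theta\in\mathcal B$ a parametric model with model class $\mathcal F_\Theta$, $C:\Theta\to[0,+\infty)$ a parameter cost, $R_\Theta:\mathcal B\to[0,+\infty]$ the parametric representation cost, $R$ its $w^*$-l.s.c. regularization, and $\mathcal F=\{f\in\mathcal B:R(f)<+\infty\}$. Let $q>0$ and $p>0$. Assume that $R_\Theta=Q_\Theta^q$, where $Q_\Theta:\mathcal B\to[0,+\infty]$ is subadditive and absolutely $p$-homogeneous. Let $\mathsf A:\mathcal B\to\mathbb R^M$ be a $w^*$-continuous linear operator such that $\mathsf A(\mathcal F_\Theta)=\mathbb R^M$. Then, for every $G:\mathbb R^M\to[0,+\infty]$ and every $\lambda>0$, $$\inf_{\theta\in\Theta}\big[G(\mathsf Af_\theta)+\lambda C(\theta)\big]=\inf_{f\in\mathcal F_\Theta}\big[G(\mathsf Af)+\lambda R_\Theta(f)\big]=\inf_{f\in\mathcal F}\big[G(\mathsf Af)+\lambda R(f)\big].$$ Consequently: (i) If $\theta^\star\in\Theta$ minimizes $\theta\mapsto G(\mathsf Af_\theta)+\lambda C(\theta)$ over $\Theta$, then $f_{\theta^\star}\in\mathcal F$ minimizes $f\mapsto G(\mathsf Af)+\lambda R(f)$ over $\mathcal F$. (ii) If $f^\star\in\mathcal F$ minimizes $f\mapsto G(\mathsf Af)+\lambda R(f)$ over $\mathcal F$, $f^\star\in\mathcal F_\Theta$, and $R(f^\star)=R_\Theta(f^\star)$,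 then $f^\star$ minimizes $f\mapsto G(\mathsf Af)+\lambda R_\Theta(f)$ over $\mathcal F_\Theta$. (iii) If, in addition to the hypotheses of (ii), there exists $\theta^\star\in\Theta$ with $f_{\theta^\star}=f^\star$ and $C(\theta^\star)=R_\Theta(f^\star)$, then $\theta^\star$ minimizes $\theta\mapsto G(\mathsf Af_\theta)+\lambda C(\theta)$ over $\Theta$.
   Context: $w^*=\sigma(\mathcal B,\mathcal A)$. $\mathcal F_\Theta=\{f_\theta:\theta\in\Theta\}$. $R_\Theta(f)=\inf\{C(\theta):\theta\in\Theta,\ f_\theta=f\}$ for $f\in\mathcal F_\Theta$ and $R_\Theta(f)=+\infty$ for $f\in\mathcal B\setminus\mathcal F_\Theta$. A function $K:\mathcal B\to[-\infty,+\infty]$ is $w^*$-l.s.c. if all sublevel sets $\{K\le\alpha\}$, $\alpha\in\mathbb R$, are $w^*$-closed; its $w^*$-l.s.c. regularization is the largest $w^*$-l.s.c. function bounded above by $K$. $K:\mathcal B\to[0,+\infty]$ is subadditive if $K(f+g)\le K(f)+K(g)$ and absolutely $p$-homogeneous if $K(0)=0$ and $K(\alpha f)=|\alpha|^pK(f)$ for all $\alpha\in\mathbb R\setminus\{0\}$, $f\in\mathcal B$. *)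

(* Defs.v *)
From HB Require Import structures.
From mathcomp Require Import all_boot all_order all_algebra.
From mathcomp Require Import all_classical all_reals all_analysis.
Import Order.TTheory GRing.Theory Num.Theory.
Import numFieldNormedType.Exports.

Set Implicit Arguments.
Unset Strict Implicit.
Unset Printing Implicit Defensive.

Local Open Scope classical_set_scope.
Local Open Scope ring_scope.

Section topological_dual.
Context {R : realType} (A : normedModType R).

Definition continuous_functional : {pred A -> R^o} :=
  fun f => `[< linear f /\ continuous f >].

Lemma continuous_functional_submod : submod_closed continuous_functional.
Proof.
split=> [|a f g /asboolP[lf cf] /asboolP[lg cg]]; apply/asboolP; split.
- by move=> k u v; change (0 = k *: (0 : R^o) + 0); rewrite scaler0 addr0.
- by move=> x; exact: cvg_cst.
- move=> k u v; change (a *: f (k *: u + v) + g (k *: u + v) =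
    k *: (a *: f u + g u) + (a *: f v + g v)); rewrite lf lg.
  by rewrite !scalerDr !scalerA (mulrC a k) addrACA.
- move=> x; apply: (@cvgD _ R^o _ _ _ (a \*: f) g); last exact: cg.
  by apply: (@cvgZl_tmp _ R^o); exact: cf.
Qed.

HB.instance Definition _ := GRing.isSubmodClosed.Build R (A -> R^o)
  continuous_functional continuous_functional_submod.

(* The topology put on the dual below is the weak* one, not that of the norm. *)
Record dual_space : Type := Dual {
  dual_fun :> A -> R^o;
  dual_funP : dual_fun \in continuous_functional }.

HB.instance Definition _ := [isSub for dual_fun].
HB.instance Definition _ := [Choice of dual_space by <:].
HB.instance Definition _ := [SubChoice_isSubLmodule of dual_space by <:].

(* sigma(A', A): the coarsest topology making all evaluations continuous *)
Definition weak_star : Type :=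
  sup_topology (fun x : A =>
    Topological.class (initial_topology (fun f : dual_space => f x))).

HB.instance Definition _ := Topological.copy dual_space weak_star.

Lemma dual_evalD (f g : dual_space) x : (f + g) x = f x + g x.
Proof. by rewrite -[LHS]/((\val (f + g)) x) raddfD. Qed.

Lemma dual_evalZ k (f : dual_space) x : (k *: f) x = k * f x.
Proof. by rewrite -[LHS]/((\val (k *: f)) x) linearZ. Qed.

Lemma weak_star_cvgP (F : set_system dual_space) (f : dual_space) : Filter F ->
  F --> f <-> forall x, (fun g : dual_space => g x) @ F --> f x.
Proof.
move=> FF; split=> [/cvg_sup Ff x|Ff].
  apply: cvg_trans (cvg_app _ (Ff x)) _.
  exact: (@initial_continuous dual_space R^o (fun g : dual_space => g x)).
apply/cvg_sup => x B [_ [[C oC <-] Cf] CB].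
by apply: filterS CB _; apply: Ff; exact: open_nbhs_nbhs.
Qed.

End topological_dual.

Section regularization.
Context {R : realType} {T : topologicalType}.
Implicit Types K L : T -> \bar R.
Local Open Scope ereal_scope.

Definition lsc K := forall a : R, closed [set x | K x <= a%:E].

Lemma lscE K : lsc K <-> lower_semicontinuous K.
Proof.
have KC a : [set x | a%:E < K x] = ~` [set x | K x <= a%:E].
  by apply/seteqP; split=> x /=; rewrite ltNge => /negP.
split=> [Kc|/lower_semicontinuousP Ko a].
  by apply/lower_semicontinuousP => a; rewrite KC openC; exact: Kc.
by rewrite -openC -KC; exact: Ko.
Qed.

(* The largest lsc minorant; that this supremum is one is shown just below. *)
Definition lsc_regularization K : T -> \bar R := fun x =>
  ereal_sup [set L x | L in [set L | lsc L /\ forall y, L y <= K y]].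

Lemma lsc_regularization_lsc K : lsc (lsc_regularization K).
Proof.
move=> a; rewrite (_ : [set _ | _] =
    \bigcap_(L in [set L | lsc L /\ forall y, L y <= K y])
      [set x | L x <= a%:E]); first by apply: closed_bigI => L [].
apply/seteqP; split=> x /= Kx => [L Ls|].
  by apply: le_trans Kx; apply: ereal_sup_ubound; exists L.
by apply: ge_ereal_sup => _ [L Ls <-]; exact: Kx.
Qed.

Lemma lsc_regularization_le K x : lsc_regularization K x <= K x.
Proof. by apply: ge_ereal_sup => _ [L [_ LK] <-]. Qed.

Lemma lsc_regularization_max K L : lsc L -> (forall x, L x <= K x) ->
  forall x, L x <= lsc_regularization K x.
Proof. by move=> Ll LK x; apply: ereal_sup_ubound; exists L. Qed.

End regularization.

Section model.
Context {R : realType} {V : Type} {Theta : Type}.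
Variables (f : Theta -> V) (C : Theta -> R).

Definition model_class : set V := range f.

(* Off the model class this is the infimum of the empty set, i.e. +oo. *)
Definition rep_cost (g : V) : \bar R :=
  ereal_inf [set (C t)%:E | t in [set t | f t = g]].

Lemma rep_cost_notin g : ~ model_class g -> rep_cost g = +oo%E.
Proof.
move=> ng; rewrite /rep_cost (_ : [set t | f t = g] = set0).
  by rewrite image_set0 ereal_inf0.
by apply/seteqP; split=> // t /= tg; apply: ng; exists t.
Qed.

End model.

Section functionals.
Context {R : realType} {V : lmodType R}.
Local Open Scope ereal_scope.

Definition subadditive_fun (K : V -> \bar R) :=
  forall f g, K (f + g)%R <= K f + K g.

Definition abs_homogeneous (p : R) (K : V -> \bar R) :=
  K 0%R = 0 /\
  forall (a : R) f, a != 0%R -> K (a *: f)%R = (`|a| `^ p)%:E * K f.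

End functionals.

Definition minimizes {R : realType} {T : Type} (D : set T) (J : T -> \bar R)
    (x : T) :=
  D x /\ forall y, D y -> (J x <= J y)%E.

(* Main.v *)
(* The regularization of [rep_cost f C] at [g] is its liminf at [g], so weak*
   close to [g] there are models [h] of cost at most [Rreg g] up to an arbitrary
   error. [T h] is then only close to [T g]; but [T] maps the domain of [Q] onto
   a finite-dimensional space, so by subadditivity and p-homogeneity a small
   vector [T g - T h] lifts to some [k] with [Q k] small. Then [T (h + k) = T g]
   and [Q (h + k)] is almost [Q h]: the infima over the fibres of [T] agree. *)

Require Import Defs.
From HB Require Import structures.
From mathcomp Require Import all_boot all_order all_algebra.
From mathcomp Require Import all_classical all_reals all_analysis.
Import Order.TTheory GRing.Theory Num.Theory.
Import numFieldNormedType.Exports.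

Local Open Scope classical_set_scope.
Local Open Scope ring_scope.

(** If [K] stayed at or above [a] near [x], some lsc minorant of [K] would take the value [a] at
    [x], and the regularization would be at least [a] there. *)
Lemma lsc_regularization_approx (R : realType) (X : topologicalType)
    (K : X -> \bar R) (x : X) (U : set X) (a : R) :
  nbhs x U -> (lsc_regularization K x < a%:E)%E ->
  exists2 y, U y & (K y < a%:E)%E.
Proof.
rewrite nbhsE => -[V [oV Vx] VU]; apply: contraPP => noy; apply/negP.
rewrite -leNgt.
(* The step function equal to [a] on [V] and [-oo] elsewhere is lsc. *)
pose L y := if `[< V y >] then a%:E else -oo%E : \bar R.
have -> : a%:E = L x by rewrite /L asboolT.
apply: lsc_regularization_max => [b|y]; rewrite /L.
  have [ab|ba] := leP a b.
    rewrite (_ : [set _ | _] = setT); first exact: closedT.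
    by apply/seteqP; split=> // y _ /=; case: ifP => _; rewrite ?lee_fin ?leNye.
  rewrite (_ : [set _ | _] = ~` V); first by rewrite closedC.
  apply/seteqP; split=> y /=.
    by case: asboolP => [_|//]; rewrite lee_fin leNgt ba.
  by move=> nVy; rewrite asboolF ?leNye.
case: asboolP => [Vy|_]; last by rewrite leNye.
by rewrite leNgt; apply/negP => Ky; apply: noy; exists y => //; exact: VU.
Qed.

Lemma lsc_regularization_ge0 (R : realType) (X : topologicalType)
    (K : X -> \bar R) (x : X) :
  (forall y, 0 <= K y)%E -> (0 <= lsc_regularization K x)%E.
Proof.
move=> K0; apply: (@lsc_regularization_max _ _ K (cst 0%E)) => // a.
have [a0|a0] := leP 0 a.
  rewrite (_ : [set _ | _] = setT); first exact: closedT.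
  by apply/seteqP; split=> // y _ /=; rewrite lee_fin.
rewrite (_ : [set _ | _] = set0); first exact: closed0.
by apply/seteqP; split=> // y /=; rewrite lee_fin leNgt a0.
Qed.

(** Lets a level [r] decrease to a cost [x] that competitors may only approach. As [x] is finite,
    [x + e / l] is a real level above it, and it raises the right-hand side by exactly [e]. *)
Lemma ge0_le_add_scale (R : realType) (l : R) (b c x : \bar R) :
  0 < l -> (0 <= x < +oo)%E ->
  (forall r : R, (x < r%:E)%E -> (b <= c + l%:E * r%:E)%E) ->
  (b <= c + l%:E * x)%E.
Proof.
move=> l0; case: x => [x| |] /andP[]// _ _ H.
apply/lee_addgt0Pr => e e0.
have := H (x + e / l); rewrite lte_fin ltrDl divr_gt0// => /(_ isT).
by rewrite -!EFinM mulrDr mulrCA divff ?gt_eqF// mulr1 EFinD addeA.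
Qed.

Section small_lift.
Local Open Scope ereal_scope.
Context {R : realType} {V : lmodType R}.
Variables (p : R) (Q : V -> \bar R).
Hypotheses (p_gt0 : (0 < p)%R) (Q_ge0 : forall g, 0 <= Q g).
Hypotheses (Q_subadd : subadditive_fun Q) (Q_hom : abs_homogeneous p Q).

Lemma subadditive_homogeneous_sum (I : Type) (s : seq I) (c : I -> R)
    (h : I -> V) :
  Q (\sum_(i <- s) c i *: h i)%R <= \sum_(i <- s) (`|c i| `^ p)%:E * Q (h i).
Proof.
elim: s => [|i s IH]; first by rewrite !big_nil Q_hom.1.
rewrite !big_cons; apply: le_trans (Q_subadd _ _) _.
apply: leeD => //.
(* Homogeneity concerns nonzero scalars; for [c i = 0] the left side is [Q 0 = 0] and the right side
   is nonnegative. *)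
have [->|c0] := eqVneq (c i) 0%R; last by rewrite Q_hom.2.
by rewrite scale0r Q_hom.1 mule_ge0// lee_fin powR_ge0.
Qed.

(** Lift the basis vectors at finite costs [B i]. Combining these lifts with the coordinates of [y]
    costs at most the finite sum of the [|y i|^p * B i], which is small with [y]. *)
Lemma small_lift (M : nat) (T : {linear V -> 'cV[R]_M}) (d : R) :
  (forall y, exists2 h, T h = y & Q h < +oo) -> (0 < d)%R ->
  exists2 e : R, (0 < e)%R & forall y : 'cV[R]_M,
    (forall i, `|y i 0%R| <= e)%R -> exists2 h, T h = y & Q h <= d%:E.
Proof.
move=> T_surj d0.
have [h Th] := choice (fun i : 'I_M => let: ex_intro2 h a b :=
  T_surj (delta_mx i 0%R) in ex_intro _ h (conj a b)).
pose B i := fine (Q (h i)).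
have QB i : Q (h i) = (B i)%:E.
  by rewrite fineK// ge0_fin_numE//; exact: (Th i).2.
have B0 i : (0 <= B i)%R by exact: fine_ge0.
(* [S] dominates the sum of the [B i], and the 1 keeps it positive when they all vanish. The radius
   chosen below has [p]-th power [d / S], so the total cost is at most [d]. *)
pose S := (1 + \sum_i B i)%R.
have S0 : (0 < S)%R by rewrite ltr_wpDr// sumr_ge0.
have dS : (0 < d / S)%R by rewrite divr_gt0.
exists ((d / S) `^ p^-1)%R; first by rewrite powR_gt0.
move=> y ye; exists (\sum_i y i 0 *: h i)%R.
  rewrite linear_sum [RHS]matrix_sum_delta; apply: eq_bigr => i _.
  by rewrite linearZ /= (Th i).1 big_ord1.
apply: le_trans (subadditive_homogeneous_sum _ _ _ _) _.
apply: (@le_trans _ _ (\sum_i (d / S * B i)%:E)).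
  apply: lee_sum => i _; rewrite QB -EFinM lee_fin ler_wpM2r//.
  have <- : (((d / S) `^ p^-1) `^ p = d / S)%R.
    by rewrite -powRrM mulVf ?gt_eqF// powRr1// ltW.
  by apply: ge0_ler_powR; rewrite ?nnegrE ?powR_ge0 ?ye// ltW.
rewrite sumEFin lee_fin -mulr_sumr mulrAC ler_pdivrMr//.
by apply: ler_wpM2l; [exact: ltW|rewrite lerDr].
Qed.

End small_lift.

Theorem theorem3p21 (R : realType) (A : completeNormedModType R)
    (Theta : Type) (f : Theta -> dual_space A)
    (C : Theta -> R) (C_ge0 : forall t, 0 <= C t)
    (p q : R) (p_gt0 : 0 < p) (q_gt0 : 0 < q)
    (Q : dual_space A -> \bar R)
    (Q_ge0 : forall g, (0 <= Q g)%E)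
    (Q_subadd : subadditive_fun Q)
    (Q_hom : abs_homogeneous p Q)
    (RQ : forall g, rep_cost f C g = (Q g `^ q)%E)
    (M : nat) (T : {linear dual_space A -> 'cV[R]_M})
    (T_cont : continuous T)
    (T_surj : T @` model_class f = setT)
    (G : 'cV[R]_M -> \bar R) (G_ge0 : forall y, (0 <= G y)%E)
    (lambda : R) (lambda_gt0 : 0 < lambda) :
  let RTheta := rep_cost f C in
  let Rreg := lsc_regularization RTheta in
  let F := [set g | (Rreg g < +oo)%E] in
  let J := fun t => (G (T (f t)) + lambda%:E * (C t)%:E)%E in
  let JTheta := fun g => (G (T g) + lambda%:E * RTheta g)%E in
  let Jreg := fun g => (G (T g) + lambda%:E * Rreg g)%E in
  [/\ ereal_inf [set J t | t in setT] =
        ereal_inf [set JTheta g | g in model_class f] /\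
      ereal_inf [set JTheta g | g in model_class f] =
        ereal_inf [set Jreg g | g in F],
      forall t, minimizes setT J t -> minimizes F Jreg (f t),
      forall g, minimizes F Jreg g -> model_class f g -> Rreg g = RTheta g ->
        minimizes (model_class f) JTheta g &
      forall g, minimizes F Jreg g -> model_class f g -> Rreg g = RTheta g ->
        forall t, f t = g -> (C t)%:E = RTheta g -> minimizes setT J t].
Proof.
move=> RTheta Rreg F J JTheta Jreg.
have RC t : (RTheta (f t) <= (C t)%:E)%E by apply: ereal_inf_lbound; exists t.
have R0 g : (0 <= RTheta g)%E.
  by apply: le_ereal_inf_tmp => _ [t _ <-]; rewrite lee_fin.
have RR g : (Rreg g <= RTheta g)%E by exact: lsc_regularization_le.
have Rreg0 g : (0 <= Rreg g)%E by exact: lsc_regularization_ge0.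
have Rfin g : model_class f g -> (RTheta g < +oo)%E.
  by move=> [t _ <-]; exact: le_lt_trans (RC t) (ltry _).
have classF g : model_class f g -> F g.
  by move=> /Rfin; exact: le_lt_trans (RR g).
have Rclass g : (RTheta g < +oo)%E -> model_class f g.
  move=> Rg; apply: contrapT => ng; move: Rg.
  by rewrite /RTheta (rep_cost_notin _ ng).
have l_mul x y : (x <= y)%E -> (lambda%:E * x <= lambda%:E * y)%E.
  by move=> xy; rewrite lee_wpmul2l// lee_fin ltW.
have JJTheta t : (JTheta (f t) <= J t)%E by apply: leeD2l; exact: l_mul.
have JregJTheta g : (Jreg g <= JTheta g)%E by apply: leeD2l; exact: l_mul.
have Qfin g : model_class f g -> (Q g < +oo)%E.
  move=> /Rfin; rewrite /RTheta RQ.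
  by case: (Q g) => [s| |]; rewrite ?ltry// poweRyr ?gt_eqF.
have lift_surj y : exists2 h, T h = y & (Q h < +oo)%E.
  have : [set: 'cV[R]_M] y by [].
  by rewrite -T_surj => -[h /Qfin Qh <-]; exists h.
have fibre g (r : R) : (Rreg g < r%:E)%E ->
    exists2 h, T h = T g & (RTheta h <= r%:E)%E.
  move=> gr.
  (* The intermediate level leaves room for the correction: [h] is found below [r0], and [h + k] has
     to stay below [r]. *)
  have [r0 [r0_ge0 gr0 r0r]] :
      exists r0 : R, [/\ 0 <= r0, (Rreg g < r0%:E)%E & r0 < r].
    move: gr (Rreg0 g); case: (Rreg g) => [s| |]//.
    rewrite lte_fin lee_fin => sr s0; have [sm mr] := midf_lt sr.
    by exists ((s + r) / 2); rewrite lte_fin sm mr (le_trans s0)// ltW.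
  have r_ge0 : 0 <= r by rewrite (le_trans r0_ge0)// ltW.
  have rootK s : 0 <= s -> (s `^ q^-1) `^ q = s.
    by move=> s0; rewrite -powRrM mulVf ?powRr1// gt_eqF.
  (* Subadditivity is available for [Q] rather than for [RTheta], so the gap between the two levels
     is measured after taking [q]-th roots. *)
  pose d := r `^ q^-1 - r0 `^ q^-1.
  have d0 : 0 < d.
    by rewrite subr_gt0 gt0_ltr_powR ?invr_gt0// nnegrE.
  have [e e0 small] :=
    small_lift _ _ p_gt0 Q_ge0 Q_subadd Q_hom _ _ _ lift_surj d0.
  have nbhs_e : nbhs g (T @^-1` ball (T g) e).
    by apply: T_cont; exact: nbhsx_ballx.
  have [h Th hr0] := lsc_regularization_approx _ _ _ _ _ _ nbhs_e gr0.
  have [k Tk Qk] : exists2 k, T k = T g - T h & (Q k <= d%:E)%E.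
    by apply: small => i; rewrite !mxE; apply: ltW; exact: (Th.2 i 0).
  exists (h + k); first by rewrite linearD Tk addrC subrK.
  have Qh : (Q h <= (r0 `^ q^-1)%:E)%E.
    rewrite leNgt; apply/negP => r0Q; move: hr0; apply/negP.
    rewrite -leNgt /RTheta RQ -{1}(rootK r0)// -poweR_EFin.
    rewrite gt0_ler_poweR ?(ltW q_gt0) ?(ltW r0Q) ?in_itv/= ?leey ?andbT//.
    by rewrite lee_fin powR_ge0.
  have Qhk : (Q (h + k)%R <= (r `^ q^-1)%:E)%E.
    rewrite (le_trans (Q_subadd _ _))// (le_trans (leeD Qh Qk))//.
    by rewrite -EFinD lee_fin addrC subrK.
  rewrite /RTheta RQ -(rootK r)// -poweR_EFin.
  rewrite gt0_ler_poweR ?(ltW q_gt0) ?in_itv/= ?leey ?andbT//.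
  by rewrite lee_fin powR_ge0.
(* The infimum defining [RTheta g] need not be attained, so a parameter of cost below [r] is taken
   for each [r] above it. *)
have infJ g : model_class f g ->
    (ereal_inf [set J t | t in setT] <= JTheta g)%E.
  move=> fg; apply: ge0_le_add_scale => //; first by rewrite R0 Rfin.
  move=> r /ereal_inf_lt[_ [t /= tg <-] tr].
  apply: (@le_trans _ _ (J t)); first by apply: ereal_inf_lbound; exists t.
  by rewrite /J tg; apply: leeD2l; apply: l_mul; exact: ltW.
(* The competitor [h] given by [fibre] has the same data term as [g], and its finite cost places it
   in the model class. *)
have infJTheta g : F g ->
    (ereal_inf [set JTheta g | g in model_class f] <= Jreg g)%E.
  move=> Fg; apply: ge0_le_add_scale => //; first by rewrite Rreg0.
  move=> r /fibre[h Th hr].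
  apply: (@le_trans _ _ (JTheta h)).
    by apply: ereal_inf_lbound; exists h => //; apply: Rclass;
      exact: le_lt_trans hr (ltry _).
  by rewrite /JTheta Th; apply: leeD2l; exact: l_mul.
have inf1 : ereal_inf [set J t | t in setT] =
    ereal_inf [set JTheta g | g in model_class f].
  apply/eqP; rewrite eq_le; apply/andP; split.
    by apply: le_ereal_inf_tmp => _ [g fg <-]; exact: infJ.
  apply: le_ereal_inf_tmp => _ [t _ <-]; apply: le_trans (JJTheta t).
  by apply: ereal_inf_lbound; exists (f t) => //; exists t.
have inf2 : ereal_inf [set JTheta g | g in model_class f] =
    ereal_inf [set Jreg g | g in F].
  apply/eqP; rewrite eq_le; apply/andP; split.
    by apply: le_ereal_inf_tmp => _ [g Fg <-]; exact: infJTheta.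
  apply: le_ereal_inf_tmp => _ [g fg <-]; apply: le_trans (JregJTheta g).
  by apply: ereal_inf_lbound; exists g => //; exact: classF.
split=> //.
(* [Jreg (f t)] is at most [J t], the infimum of [J]; this is also the infimum of [JTheta], which
   [infJTheta] bounds by [Jreg g]. *)
- move=> t [_ tmin]; split; first by apply: classF; exists t.
  move=> g Fg; apply: le_trans (infJTheta g Fg); rewrite -inf1.
  apply: (le_trans (JregJTheta _)); apply: (le_trans (JJTheta t)).
  by apply: le_ereal_inf_tmp => _ [u _ <-]; exact: tmin.
- move=> g [Fg gmin] fg gE; split=> // h fh; rewrite /JTheta -gE.
  by apply: le_trans (JregJTheta h); apply: gmin; exact: classF.
- move=> g [Fg gmin] fg gE t tg Ct; split=> // u _.
  rewrite /J tg Ct -gE; apply: le_trans (JJTheta u).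
  by apply: le_trans (JregJTheta _); apply/gmin/classF; exists u.
Qed.
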